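(* Let $q \ge 3$ and $d \ge 1$ be odd integers such that $q+d$ is a power of $2$. Let $T_{q,d} : \mathbb{Z}_{>0} \to \mathbb{Z}_{>0}$ be the generalized Collatz map given by $T_{q,d}(n) = n/2$ if $n$ is even and $T_{q,d}(n) = (qn+d)/2$ if $n$ is odd, and let $R = \{(x,z) \in \mathbb{Z}_{>0}^2 : z = T_{q,d}^k(x) \text{ for some integer } k \ge 0\}$ be its reachability relation. Then $R$, viewed as a subset of $\mathbb{N}^2$, is not first-order definable in base-$q$ Büchi arithmetic $\mathrm{BA}_q = \langle \mathbb{N}, +, V_q \rangle$.
   Context: $\mathbb{N} = \{0,1,2,\dots\}$. $T_{q,d}^k$ denotes the $k$-fold iterate of $T_{q,d}$, with $T_{q,d}^0$ the identity. Base-$q$ Büchi arithmetic $\mathrm{BA}_q = \langle \mathbb{N}, +, V_q\rangle$ is the first-order structure with domain $\mathbb{N}$, addition, and the unary function $V_q$, where $V_q(n)$ is the largest power of $q$ dividing $n$ (for $n=0$ take the convention $V_q(0)=1$). A set $S \subseteq \mathbb{N}^k$ is first-order definable in $\mathrm{BA}_q$ if there is a first-order formula over this structure with $k$ free variables whose set of satisfying tuples is exactly $S$. The relation $R$ is regarded as a relation over $\mathbb{N}$ in which no pair has a coordinate equal to $0$. *)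

(* Defs.v *)
From mathcomp Require Import all_boot.

Set Implicit Arguments.
Unset Strict Implicit.
Unset Printing Implicit Defensive.

(* [logn q] is not usable here: it is meaningful for prime [q] only.  For
   [1 < q] and [0 < n] every power [q ^ i] dividing [n] has [i < n], so the
   bound on [i] loses nothing (see [VqP]). *)
Definition Vq (q n : nat) : nat :=
  if n == 0 then 1 else \max_(i < n.+1 | q ^ i %| n) q ^ i.

Lemma VqP (q n : nat) : 1 < q -> 0 < n ->
  [/\ exists e, Vq q n = q ^ e, Vq q n %| n
    & forall e, q ^ e %| n -> q ^ e <= Vq q n].
Proof.
move=> q1 n0; rewrite /Vq -[n == 0]negbK -lt0n n0 /=.
have P0 : q ^ (ord0 : 'I_n.+1) %| n by rewrite expn0 dvd1n.
split.
- by rewrite (bigmax_eq_arg ord0) //; case: arg_maxnP => // i _ _; exists i.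
- by rewrite (bigmax_eq_arg ord0) //; case: arg_maxnP.
move=> e e_n; have ltn : e < n.+1.
  by rewrite ltnS ltnW // (leq_trans (ltn_expl e q1)) // dvdn_leq.
exact: (@leq_bigmax_cond _ (fun i : 'I_n.+1 => q ^ i %| n)
          (fun i => q ^ i) (Ordinal ltn)).
Qed.

(* First-order logic with equality over the signature (+, V), well-scoped:
   [ba_term n] and [ba_formula n] have their free variables in ['I_n], and a
   quantifier binds variable 0, shifting the others up by one. *)
Inductive ba_term (n : nat) : Type :=
  | Var of 'I_n
  | Add of ba_term n & ba_term n
  | VApp of ba_term n.

Inductive ba_formula : nat -> Type :=
  | Eq n of ba_term n & ba_term n : ba_formula n
  | Not n of ba_formula n : ba_formula n
  | And n of ba_formula n & ba_formula n : ba_formula n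
  | Or n of ba_formula n & ba_formula n : ba_formula n
  | Imp n of ba_formula n & ba_formula n : ba_formula n
  | All n of ba_formula n.+1 : ba_formula n
  | Ex n of ba_formula n.+1 : ba_formula n.

Fixpoint ba_eval (q n : nat) (v : n.-tuple nat) (t : ba_term n) : nat :=
  match t with
  | Var i => tnth v i
  | Add t1 t2 => ba_eval q v t1 + ba_eval q v t2
  | VApp t1 => Vq q (ba_eval q v t1)
  end.

Fixpoint ba_sat (q n : nat) (f : ba_formula n) : n.-tuple nat -> Prop :=
  match f in ba_formula n return n.-tuple nat -> Prop with
  | Eq _ t1 t2 => fun v => ba_eval q v t1 = ba_eval q v t2
  | Not _ f1 => fun v => ~ ba_sat q f1 v
  | And _ f1 f2 => fun v => ba_sat q f1 v /\ ba_sat q f2 v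
  | Or _ f1 f2 => fun v => ba_sat q f1 v \/ ba_sat q f2 v
  | Imp _ f1 f2 => fun v => ba_sat q f1 v -> ba_sat q f2 v
  | All _ f1 => fun v => forall a : nat, ba_sat q f1 [tuple of a :: v]
  | Ex _ f1 => fun v => exists a : nat, ba_sat q f1 [tuple of a :: v]
  end.

Definition ba_definable (q k : nat) (S : k.-tuple nat -> Prop) : Prop :=
  exists f : ba_formula k, forall v : k.-tuple nat, ba_sat q f v <-> S v.

(* For odd [q] and [d] both halvings are exact, and positive integers are
   mapped to positive integers; the value at 0 is never used below. *)
Definition collatz (q d n : nat) : nat :=
  if odd n then (q * n + d)./2 else n./2.

Definition reach (q d x z : nat) : Prop :=
  [/\ 0 < x, 0 < z & exists k : nat, z = iter k (collatz q d) x].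

(* Main.v *)
Require Import Defs.
From mathcomp Require Import all_boot.
From mathcomp Require Import zify.
From Stdlib Require Import Classical.

Set Implicit Arguments.
Unset Strict Implicit.
Unset Printing Implicit Defensive.

(** The odd step [n |-> (q n + d) / 2] never produces a multiple of [q]: twice
    its value is congruent to [d] modulo [q], and [d] is prime to [q] because
    [q + d] is a power of 2 and [q] is odd.  Hence an orbit that arrives at
    [q] has only passed through multiples of [q], by halvings, and the points
    from which [q] is reachable are exactly the numbers [q * 2 ^ k]
    ([reach_qE]).

    It remains to see that Büchi arithmetic in an odd base cannot define
    [{q * 2 ^ k}].  By the Büchi-Bruyère theorem definable relations are
    recognized by finite automata reading base-[q] digits.  Automata appear
    here through residuals: the residual of a relation [P] by a tuple of digits
    [r] is the relation [v |-> P (q v + r)], and [P] is [automatic] when it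
    belongs to a finite family of relations closed under residuals.  In this
    form the digits are read from the least significant one, and numbers of
    different lengths need no padding, since the digits still to be read are
    given by a number, not by a word.  Closure under the connectives
    ([automatic_connective]) and under existential quantification
    ([automatic_ex]) then makes every formula automatic ([automatic_sat]).

    An automatic set can be pumped ([automatic_pumping]): an element with many
    digits gives another one by repeating a block of digits.  Pumping
    [c * 2 ^ K], with [K] huge compared with the position of the block, by a
    block of [p] digits changes it into [q ^ p * (c * 2 ^ K) + e] with [e]
    small; for this to be some [c * 2 ^ K'] with [K' > K], the error [e] must
    be a multiple of [2 ^ K], hence 0, and then [2 ^ (K' - K) = q ^ p] has the
    wrong parity ([not_automatic_pow2]). *)

(** * Automatic relations *)

(** Componentwise, the number whose base-[q] expansion is that of [v] followed
    by the least significant digit [r]. *)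
Definition snoc_digits (q n : nat) (r : n.-tuple 'I_q) (v : n.-tuple nat) :
    n.-tuple nat :=
  [tuple q * tnth v i + tnth r i | i < n].

(** The state [i] of the automaton is identified with the relation [F i] that
    the digits still to be read must satisfy. *)
Definition automatic (q n : nat) (P : n.-tuple nat -> Prop) : Prop :=
  exists (I : finType) (delta : I -> n.-tuple 'I_q -> I)
         (F : I -> n.-tuple nat -> Prop) (i0 : I),
    (forall v, F i0 v <-> P v) /\
    (forall i r v, F i (snoc_digits r v) <-> F (delta i r) v).

Lemma automatic_ext (q n : nat) (P Q : n.-tuple nat -> Prop) :
  (forall v, P v <-> Q v) -> automatic q P -> automatic q Q.
Proof.
move=> PQ [I [delta [F [i0 [F0 Fd]]]]]; exists I, delta, F, i0; split=> // v.
by rewrite F0.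
Qed.

(** The product of two automata; [c] is any extensional connective, so that
    conjunction, disjunction, implication and negation need one proof only. *)
Lemma automatic_connective (q n : nat) (c : Prop -> Prop -> Prop)
    (P Q : n.-tuple nat -> Prop) :
  (forall A A' B B', (A <-> A') -> (B <-> B') -> (c A B <-> c A' B')) ->
  automatic q P -> automatic q Q -> automatic q (fun v => c (P v) (Q v)).
Proof.
move=> c_iff [I [dI [F [i0 [F0 Fd]]]]] [J [dJ [G [j0 [G0 Gd]]]]].
exists (I * J)%type, (fun s r => (dI s.1 r, dJ s.2 r)),
  (fun s v => c (F s.1 v) (G s.2 v)), (i0, j0).
by split=> [v | s r v]; apply: c_iff.
Qed.

Lemma automatic_not (q n : nat) (P : n.-tuple nat -> Prop) :
  automatic q P -> automatic q (fun v => ~ P v).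
Proof.
move=> aP.
apply: (automatic_connective (c := fun A _ => ~ A) _ aP aP).
by move=> A A' B B' -> _.
Qed.

Lemma automatic_and (q n : nat) (P Q : n.-tuple nat -> Prop) :
  automatic q P -> automatic q Q -> automatic q (fun v => P v /\ Q v).
Proof.
move=> aP aQ.
by apply: (automatic_connective (c := and) _ aP aQ) => A A' B B' -> ->.
Qed.

Lemma snoc_digits_cons (q n s a : nat) (sq : s < q) (r : n.-tuple 'I_q)
    (v : n.-tuple nat) :
  snoc_digits [tuple of Ordinal sq :: r] [tuple of a :: v] =
  [tuple of q * a + s :: snoc_digits r v].
Proof.
apply: eq_from_tnth => i; rewrite tnth_mktuple.
by case: (unliftP ord0 i) => [j|] ->; rewrite ?tnth0 // !tnthS tnth_mktuple.
Qed.

(** The powerset construction.  The digits of the witness are guessed: the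
    residual of [exists a, F i (a :: v)] is the disjunction, over the digit [s]
    of [a], of the statements [exists a, F (delta i (s :: r)) (a :: v)].
    Disjunctions of such statements are indexed by sets of states. *)
Lemma automatic_ex (q n : nat) (P : n.+1.-tuple nat -> Prop) : 0 < q ->
  automatic q P -> automatic q (fun v => exists a, P [tuple of a :: v]).
Proof.
move=> q_gt0 [I [delta [F [i0 [F0 Fd]]]]].
exists {set I},
  (fun (J : {set I}) (r : n.-tuple 'I_q) =>
    [set delta i [tuple of s :: r] | i in J, s in 'I_q]),
  (fun (J : {set I}) (v : n.-tuple nat) =>
    exists2 i, i \in J & exists a, F i [tuple of a :: v]), [set i0].
split=> [v | J r v].
  split=> [[i /set1P-> [a /F0 Pa]] | [a /F0 Fa]]; first by exists a.
  by exists i0; [rewrite set11 | exists a].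
split=> [[i iJ [a Fa]] | [_ /imset2P[i [s sq] iJ _ ->] [a Fa]]]; last first.
  exists i => //; exists (q * a + s).
  by rewrite -(snoc_digits_cons _ sq); apply/Fd.
have sq : a %% q < q by rewrite ltn_pmod.
exists (delta i [tuple of Ordinal sq :: r]); first exact: imset2_f.
by exists (a %/ q); apply/Fd; rewrite snoc_digits_cons mulnC -divn_eq.
Qed.

(** Coordinates of [P] are replaced by variables or by the constant [c].  The
    residual of a constant [e] is the constant [e %/ q], so the constants that
    occur are at most [c] and can be remembered in the state. *)
Lemma automatic_subst (q m n c : nat) (f : 'I_m -> option 'I_n)
    (P : m.-tuple nat -> Prop) : 0 < q -> automatic q P ->
  automatic q (fun v => P [tuple oapp (tnth v) c (f i) | i < m]).
Proof.
move=> q_gt0 [I [delta [F [i0 [F0 Fd]]]]].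
pose digit e := Ordinal (ltn_pmod e q_gt0).
exists (I * 'I_c.+1)%type,
  (fun (s : I * 'I_c.+1) (r : n.-tuple 'I_q) =>
    (delta s.1 [tuple oapp (tnth r) (digit s.2) (f i) | i < m],
     inord (s.2 %/ q))),
  (fun (s : I * 'I_c.+1) (v : n.-tuple nat) =>
    F s.1 [tuple oapp (tnth v) (s.2 : nat) (f i) | i < m]),
  (i0, ord_max).
split=> [v | [i e] r v] /=; first exact: F0.
rewrite -Fd; set w := mktuple _; set w' := snoc_digits _ _.
suff -> : w = w' by [].
apply: eq_from_tnth => j; rewrite !tnth_mktuple.
case: (f j) => [k|] /=; first by rewrite tnth_mktuple.
by rewrite inordK ?ltnS ?(leq_trans (leq_div _ _)) -1?ltnS // mulnC -divn_eq.
Qed.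

(** * The atomic relations *)

Lemma snoc_digit_inj (q x a y b : nat) : a < q -> b < q ->
  q * x + a = q * y + b <-> a = b /\ x = y.
Proof.
move=> aq bq; split=> [e | [-> ->]] //.
have ab : a = b.
  by have := congr1 (modn^~ q) e; rewrite ![q * _]mulnC !modnMDl !modn_small.
split=> //; move/eqP: e; rewrite ab eqn_add2r eqn_pmul2l; first by move/eqP.
exact: leq_ltn_trans bq.
Qed.

Lemma automatic_eq (q n : nat) (i j : 'I_n) :
  automatic q (fun v => tnth v i = tnth v j).
Proof.
exists bool, (fun s r => s && (tnth r i == tnth r j)),
  (fun (s : bool) v => s /\ tnth v i = tnth v j), true.
split=> [v | s r v]; first by split=> [[]|].
rewrite !tnth_mktuple -(inj_eq val_inj) /=.
have := ltn_ord (tnth r i); have := ltn_ord (tnth r j).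
move: (tnth v i) (tnth v j) (nat_of_ord _) (nat_of_ord _) => x y b a bq aq.
split=> [[-> e]|[/andP[-> /eqP->] ->]] //.
by have [-> ->] := (snoc_digit_inj x y aq bq).1 e; rewrite eqxx.
Qed.

(** The state is the carry, or [None] once a digit of the sum is wrong. *)
Lemma automatic_add (q n : nat) (i j k : 'I_n) :
  automatic q (fun v => tnth v i + tnth v j = tnth v k).
Proof.
pose carry (c : bool) (r : n.-tuple 'I_q) := q <= tnth r i + tnth r j + c.
exists (option bool),
  (fun (s : option bool) (r : n.-tuple 'I_q) =>
    if s is Some c then
      if tnth r i + tnth r j + c == q * carry c r + tnth r k
      then Some (carry c r) else None
    else None),
  (fun (s : option bool) v =>
    if s is Some c then tnth v i + tnth v j + (c : bool) = tnth v k else False),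
  (Some false).
split=> [v | [c|] r v] //; first by rewrite addn0.
rewrite !tnth_mktuple /carry.
have := ltn_ord (tnth r i); have := ltn_ord (tnth r j).
have := ltn_ord (tnth r k).
move: (tnth v i) (tnth v j) (tnth v k) => x y z.
move: (nat_of_ord _) (nat_of_ord _) (nat_of_ord _) => a b e eq bq aq.
set t := a + b + c; set u := q <= t.
have tE : t = q * u + (t - q * u) /\ t - q * u < q.
  by rewrite /u; case: leqP; rewrite /t; case: (c) => /=; lia.
move: tE; move: (t - q * u) => s [tE sq].
have -> : q * x + a + (q * y + b) + c = q * (x + y + u) + s.
  by move: tE; rewrite /t !mulnDr; lia.
rewrite snoc_digit_inj // tE eqn_add2l.
case: (s =P e) => [->|ne]; first by split=> [[]|].
by split=> [[]|].
Qed.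

Lemma Vq_mull (q x : nat) : 1 < q -> 0 < x -> Vq q (q * x) = q * Vq q x.
Proof.
move=> q1 x0; have q0 := ltnW q1.
have [[e Ve] dV maxV] := VqP q1 x0.
have [[e' Ve'] dV' maxV'] : [/\ exists e, Vq q (q * x) = q ^ e,
  Vq q (q * x) %| q * x & forall e, q ^ e %| q * x -> q ^ e <= Vq q (q * x)].
  by apply: VqP => //; rewrite muln_gt0 q0.
apply/eqP; rewrite eqn_leq; apply/andP; split; last first.
  by rewrite Ve -expnS maxV' // expnS dvdn_pmul2l // -Ve.
have := maxV' 1; rewrite expn1 dvdn_mulr // => /(_ isT).
rewrite Ve'; case: e' Ve' => [|e' Ve' _]; first by rewrite expn0 leqNgt q1.
by rewrite expnS leq_pmul2l // maxV // -(dvdn_pmul2l q0) -expnS -Ve'.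
Qed.

Lemma Vq_digit (q x a : nat) : 0 < a < q -> Vq q (q * x + a) = 1.
Proof.
case/andP=> a0 aq; have q1 : 1 < q by apply: leq_ltn_trans aq.
have n0 : 0 < q * x + a by rewrite addn_gt0 a0 orbT.
have [[[|e] -> dV _] // ] := VqP q1 n0.
move: dV; rewrite expnS => /(dvdn_trans (dvdn_mulr _ (dvdnn q))).
by rewrite dvdn_addr ?dvdn_mulr // => /(dvdn_leq a0); rewrite leqNgt aq.
Qed.

Lemma Vq_gt0 (q x : nat) : 1 < q -> 0 < Vq q x.
Proof.
move=> q1; have [->//|x0] := posnP x.
by have [[e ->] _ _] := VqP q1 x0; rewrite expn_gt0 ltnW.
Qed.

(** The graph of [Vq q] says that the lowest nonzero digit of [x] is at the
    position of the only nonzero digit of [y], which is 1.  The first component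
    of the state tells that this position is not yet reached.  The second
    component accommodates the convention [Vq q 0 = 1]: the only way to accept
    [x = 0] is that the very first digit of [y] be 1, so zero is still possible
    for the rest of [x] in the initial state [(true, true)], excluded in
    [(true, false)], forced in [(false, false)], and one of the many possible
    values in [(false, true)]. *)
Lemma automatic_Vq (q n : nat) (i j : 'I_n) : 1 < q ->
  automatic q (fun v => Vq q (tnth v i) = tnth v j).
Proof.
move=> q1; have q0 := ltnW q1.
pose G s x y := match s with
  | Some (true, true) => Vq q x = y
  | Some (true, false) => 0 < x /\ Vq q x = y
  | Some (false, true) => y = 0
  | Some (false, false) => x = 0 /\ y = 0
  | None => False
  end.
pose d s a b := match s with
  | Some (true, z) =>
      if 0 < a then if b == 1 then Some (false, true) else None
      else if b == 0 then Some (true, false)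
      else if z && (b == 1) then Some (false, false) else None
  | Some (false, true) => if b == 0 then s else None
  | Some (false, false) => if (a == 0) && (b == 0) then s else None
  | None => None
  end.
have Gd s x y a b : a < q -> b < q ->
    G s (q * x + a) (q * y + b) <-> G (d s a b) x y.
  move=> aq bq; case: s => [[[] z]|] //=; last first.
    case: z; first by case: eqP => /=; nia.
    by case: eqP; case: eqP => /=; nia.
  have eq1 : 1 = q * y + b <-> 1 = b /\ 0 = y.
    by have := snoc_digit_inj 0 y q1 bq; rewrite muln0.
  have eqV V : q * V = q * y + b <-> 0 = b /\ V = y.
    by have := snoc_digit_inj V y q0 bq; rewrite addn0.
  case: (posnP a) => [a0|a0] /=.
    rewrite a0 addn0; have [x0|x0] := posnP x.
      have -> : Vq q (q * x) = 1 by rewrite x0 muln0.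
      have V1 : Vq q x = 1 by rewrite x0.
      rewrite {1}x0 muln0.
      by case: z; rewrite eq1; clear -V1 x0;
        case: b => [|[|b]] /=; rewrite ?V1; lia.
    rewrite Vq_mull // muln_gt0 q0 x0 /=.
    by case: z; rewrite eqV; clear -x0; case: b => [|[|b]] /=; lia.
  rewrite Vq_digit ?a0 // addn_gt0 a0 orbT.
  by case: z; rewrite eq1; clear; case: b => [|[|b]] /=; lia.
exists (option (bool * bool)),
  (fun s (r : n.-tuple 'I_q) => d s (tnth r i) (tnth r j)),
  (fun s v => G s (tnth v i) (tnth v j)), (Some (true, true)).
by split=> // s r v; rewrite !tnth_mktuple; apply: Gd.
Qed.

(** * Definable relations are automatic *)

(** The values of the subterms are existentially quantified, which adds
    variables in front; the renaming [f] of the variables of [t] keeps the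
    induction hypothesis applicable in the extended context. *)
Lemma automatic_term (q n : nat) (t : ba_term n) : 1 < q ->
  forall m (f : 'I_n -> 'I_m) (k : 'I_m),
  automatic q (fun v => ba_eval q [tuple tnth v (f i) | i < n] t = tnth v k).
Proof.
move=> q1; have q0 := ltnW q1.
have skip m (f : 'I_n -> 'I_m) a (v : m.-tuple nat) :
    [tuple tnth [tuple of a :: v] (lift ord0 (f i)) | i < n]
      = [tuple tnth v (f i) | i < n].
  by apply: eq_from_tnth => i; rewrite !tnth_mktuple tnthS.
elim: t => [i | t1 IH1 t2 IH2 | t1 IH1] m f k.
- apply: automatic_ext (automatic_eq q (f i) k) => v.
  by rewrite /= tnth_mktuple.
- pose up i := lift ord0 (lift ord0 i) : 'I_m.+2.
  have := automatic_ex q0 (automatic_ex q0 (automatic_and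
    (automatic_and (IH1 _ (up \o f) ord0) (IH2 _ (up \o f) (lift ord0 ord0)))
    (automatic_add q ord0 (lift ord0 ord0) (up k)))).
  apply: automatic_ext => v; rewrite /= /up.
  set e1 := ba_eval q _ t1; set e2 := ba_eval q _ t2.
  split=> [[b [a]] | vk]; last exists e2, e1;
    rewrite !skip !tnthS !tnth0 -/e1 -/e2 //.
  by case=> [[-> ->]].
- have := automatic_ex q0 (automatic_and
    (IH1 _ (lift ord0 \o f) ord0) (automatic_Vq ord0 (lift ord0 k) q1)).
  apply: automatic_ext => v /=.
  set e1 := ba_eval q _ t1.
  split=> [[a] | vk]; last exists e1; rewrite skip tnthS tnth0 -/e1 //.
  by case=> ->.
Qed.

Lemma automatic_sat (q n : nat) (f : ba_formula n) : 1 < q ->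
  automatic q (ba_sat q f).
Proof.
move=> q1; have q0 := ltnW q1.
elim: f => {n} [n t1 t2 | n f aF | n f aF g aG | n f aF g aG | n f aF g aG
  | n f aF | n f aF] /=.
- have := automatic_ex q0 (automatic_and
    (automatic_term t1 q1 (lift ord0) ord0)
    (automatic_term t2 q1 (lift ord0) ord0)).
  apply: automatic_ext => v.
  have skip a : [tuple tnth [tuple of a :: v] (lift ord0 i) | i < n] = v.
    by apply: eq_from_tnth => i; rewrite tnth_mktuple tnthS.
  split=> [[a] | e]; last exists (ba_eval q v t2); rewrite skip tnth0 //.
  by case=> ->.
- exact: automatic_not.
- exact: automatic_and.
- by apply: (automatic_connective (c := or) _ aF aG) => A A' B B' -> ->.
- apply: (automatic_connective (c := fun A B => A -> B) _ aF aG).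
  by move=> A A' B B' -> ->.
- have := automatic_not (automatic_ex q0 (automatic_not aF)).
  apply: automatic_ext => v; split=> [nex a | all [a]]; last by apply.
  by apply: NNPP => na; apply: nex; exists a.
- exact: automatic_ex.
Qed.

(** * Pumping and powers of two *)

(** Among the residuals of [S] by the [k] lowest digits of [n], for [k] from 0
    to the number of states, two coincide, say for [k < l]; then the digits of
    [n] above position [k] may be put on top of its [l] lowest digits, which
    repeats the block of digits between positions [k] and [l]. *)
Lemma automatic_pumping (q : nat) (S : nat -> Prop) : 0 < q ->
  automatic q (fun v : 1.-tuple nat => S (tnth v ord0)) ->
  exists N, forall n, S n ->
    exists k l, k < l <= N /\ S (q ^ l * (n %/ q ^ k) + n %% q ^ l).
Proof.
move=> q0 [I [delta [F [i0 [F0 Fd]]]]]; exists #|I| => n Sn.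
pose digit k := Ordinal (ltn_pmod (n %/ q ^ k) q0).
pose state := fix state k :=
  if k is k'.+1 then delta (state k') [tuple digit k'] else i0.
have stateP k y : F (state k) [tuple y] <-> S (q ^ k * y + n %% q ^ k).
  elim: k y => [|k IH] y /=; first by rewrite F0 modn1 mul1n addn0.
  rewrite -Fd.
  have -> : snoc_digits [tuple digit k] [tuple y]
           = [tuple q * y + (n %/ q ^ k) %% q].
    by apply: eq_from_tnth => i; rewrite tnth_mktuple !ord1.
  rewrite IH.
  suff -> : n %% q ^ k.+1 = q ^ k * ((n %/ q ^ k) %% q) + n %% q ^ k.
    by rewrite expnSr -mulnA addnA mulnDr.
  rewrite {1}(divn_eq n (q ^ k)) {1}(divn_eq (n %/ q ^ k) q) mulnDl.
  rewrite -mulnA -expnS -addnA modnMDl mulnC modn_small //.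
  have := ltn_pmod (n %/ q ^ k) q0.
  have : n %% q ^ k < q ^ k by rewrite ltn_pmod // expn_gt0 q0.
  rewrite expnS; nia.
pose st (k : 'I_#|I|.+1) := state k.
have /injectivePn[k [l]] : ~~ injectiveb st.
  apply: contraTN (leqnn #|I|) => /injectiveP inj.
  by rewrite -ltnNge; have := leq_card st inj; rewrite card_ord.
wlog kl : k l / k < l => [th|].
  case: (ltngtP k l) => [|lk|/val_inj->]; [exact: th | | by rewrite eqxx].
  by move=> kl e; apply: (th l k lk); rewrite // eq_sym.
move=> _ e; exists k, l; split; first by rewrite kl -ltnS ltn_ord.
apply/stateP; have <- : st k = state l by [].
by apply/stateP; rewrite mulnC -divn_eq.
Qed.

(** The pumped number [q ^ l * y + n %% q ^ l] differs from [q ^ p * n], where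
    [p = l - k], by [n %% q ^ l - q ^ p * (n %% q ^ k)].  Both terms are below
    [q ^ l <= q ^ N < 2 ^ K], whereas [2 ^ K] divides the difference. *)
Lemma not_automatic_pow2 (q c : nat) : 1 < q -> odd q -> 0 < c ->
  ~ automatic q (fun v : 1.-tuple nat => exists k, tnth v ord0 = c * 2 ^ k).
Proof.
move=> q1 q_odd c0 aut.
have [N pump] :=
  automatic_pumping (S := fun x => exists k, x = c * 2 ^ k) (ltnW q1) aut.
(* With this exponent [q ^ N = K < 2 ^ K]. *)
pose K := q ^ N; pose n := c * 2 ^ K.
have [|k [l [/andP[kl lN] [K' n'E]]]] := pump n; first by exists K.
move: n'E; set y := n %/ q ^ k => n'E; pose p := l - k.
have p0 : 0 < p by rewrite subn_gt0.
have qlE : q ^ l = q ^ p * q ^ k by rewrite -expnD subnK // ltnW.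
have nE : n = q ^ k * y + n %% q ^ k by rewrite mulnC -divn_eq.
have rl : n %% q ^ l < q ^ l by rewrite ltn_pmod // expn_gt0 ltnW.
have rk : n %% q ^ k < q ^ k by rewrite ltn_pmod // expn_gt0 ltnW.
have qlK : q ^ l < 2 ^ K.
  by apply: leq_ltn_trans (ltn_expl K (leqnn 2)); rewrite leq_pexp2l // ltnW.
have Kn : 2 ^ K <= n by rewrite leq_pmull.
have qp : 1 < q ^ p by rewrite -(expn0 q) ltn_exp2l.
have y0 : 0 < y.
  rewrite divn_gt0 ?expn_gt0 ?(ltnW q1) //; nia.
have KK' : K < K'.
  rewrite -(ltn_exp2l _ _ (leqnn 2)) -(ltn_pmul2l c0) -n'E -/n; nia.
have prk : q ^ p * (n %% q ^ k) < 2 ^ K.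
  by apply: ltn_trans qlK; rewrite qlE ltn_pmul2l // ltnW.
have nK : q ^ p * n = q ^ p * c * 2 ^ K by rewrite mulnA.
have n'K : c * 2 ^ K' = c * 2 ^ (K' - K) * 2 ^ K.
  by rewrite -mulnA -expnD subnK // ltnW.
have rE : n %% q ^ l = q ^ p * (n %% q ^ k).
  have : q ^ p * n + n %% q ^ l = c * 2 ^ K' + q ^ p * (n %% q ^ k).
    by rewrite -n'E {1}nE qlE mulnDr mulnA addnAC.
  rewrite nK n'K => /(congr1 (modn^~ (2 ^ K))).
  by rewrite !modnMDl (modn_small prk) (modn_small (ltn_trans rl qlK)).
have : 2 ^ (K' - K) * 2 ^ K = q ^ p * 2 ^ K.
  rewrite -expnD subnK ?(ltnW KK') //.
  apply/eqP; rewrite -(eqn_pmul2l c0) mulnCA -/n -n'E rE {2}nE qlE.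
  by rewrite mulnDr mulnA.
move/eqP; rewrite eqn_pmul2r ?expn_gt0 // => /eqP/(congr1 odd).
by rewrite !oddX q_odd orbT /= orbF subn_eq0 leqNgt KK'.
Qed.

(** * Orbits arriving at q *)

(** Going backwards from [q * 2 ^ k], an odd predecessor [x] would satisfy
    [q x + d = q * 2 ^ k.+1], so that [q] would divide [d]. *)
Lemma reach_qE (q d x : nat) : 1 < q -> odd q -> odd d ->
  coprime q d -> reach q d x q <-> exists k, x = q * 2 ^ k.
Proof.
move=> q1 q_odd d_odd qd; have q0 := ltnW q1.
split=> [[_ _ [k qE]] | [k ->]]; last first.
  split=> //; first by rewrite muln_gt0 q0 expn_gt0.
  exists k; elim: k => [|k IH]; first by rewrite muln1.
  rewrite iterSr expnS [collatz _ _ _](_ : _ = q * 2 ^ k) //.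
  by rewrite /collatz mulnCA mul2n odd_double doubleK.
exists k; elim: k x qE => [|k IH] x; first by rewrite muln1.
rewrite iterSr => /IH; rewrite /collatz; case: ifP => [x_odd | x_even] xE.
  have even_img : ~~ odd (q * x + d) by rewrite oddD oddM q_odd x_odd d_odd.
  have : q %| q * x + d.
    by rewrite -(even_halfK even_img) xE -mul2n mulnCA dvdn_mulr.
  rewrite dvdn_addr ?dvdn_mulr // => /gcdn_idPl.
  by rewrite (eqP qd) => q_eq1; rewrite -q_eq1 in q1.
by rewrite -(even_halfK (negbT x_even)) xE expnS -mul2n mulnCA.
Qed.

Theorem theorem2 (q d : nat) (q_ge3 : 3 <= q) (d_ge1 : 1 <= d)
  (q_odd : odd q) (d_odd : odd d) (qd_pow2 : exists m : nat, q + d = 2 ^ m) :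
  ~ @ba_definable q 2 (fun v : 2.-tuple nat =>
      reach q d (tnth v ord0) (tnth v ord_max)).
Proof.
have q1 : 1 < q by apply: ltnW.
have qd : coprime q d.
  have [m qdE] := qd_pow2.
  rewrite /coprime -(gcdnDr q d) addnC qdE -/(coprime _ _).
  by rewrite coprimeXr ?coprimen2.
(* The section of the reachability relation at [z = q]. *)
case=> f fP; pose x_only (i : 'I_2) : option 'I_1 :=
  if i == ord0 then Some ord0 else None.
have := automatic_subst q x_only (ltnW q1)
  (automatic_ext fP (automatic_sat f q1)).
move=> aut; apply: (@not_automatic_pow2 q q q1 q_odd (ltnW q1)).
apply: automatic_ext aut => v; rewrite !tnth_mktuple /=.
exact: reach_qE.
Qed.
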